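(* For every $i=1,\dots,N$ the following hold. 1) The continuous embedding $W^{s_i}L_{\Phi^i_{x,y}}(Q)\subset W^{s_i}L_{\Phi^i_{x,y}}(\Omega)$ (by restriction to $\Omega$) holds true. 2) If $u\in W_0^{s_i}L_{\Phi^i_{x,y}}(Q)$, then $u\in W^{s_i}L_{\Phi^i_{x,y}}(\mathbb R^N)$ and $$\|u\|_{s_i,\Phi^i_{x,y}}\le\|u\|_{W^{s_i}L_{\Phi^i_{x,y}}(\mathbb R^N)}=\|u\|_i .$$
   Context: Let $N\ge1$, $\Omega\subset\mathbb R^N$ open, $s_1,\dots,s_N\in(0,1)$, $C\Omega=\mathbb R^N\setminus\Omega$, $Q=\mathbb R^{2N}\setminus(C\Omega\times C\Omega)$. For each $i$, $a^i:\mathbb R^N\times\mathbb R^N\times\mathbb R\to\mathbb R$ satisfies $a^i(x,y,t)=a^i(y,x,t)$, and for all $(x,y)$ the function $\varphi^i_{x,y}(t)=a^i(x,y,|t|)t$ for $t\ne0$, $\varphi^i_{x,y}(0)=0$, is an increasing homeomorphism of $\mathbb R$ onto itself. Put $\Phi^i_{x,y}(t)=\int_0^t\varphi^i_{x,y}(\tau)\,d\tau$ for $t\ge0$; $\Phi^i$ is a Musielak function (in particular measurable in $(x,y)$). Put $\widehat\Phi^i_x=\Phi^i_{x,x}$. Assume for each $i$: ($\Phi_1$) there are constants with $1<\varphi_i^-\le \frac{t\varphi^i_{x,y}(t)}{\Phi^i_{x,y}(t)}\le\varphi_i^+<\infty$ for all $(x,y)$ and $t>0$; ($\Phi_2$)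 $t\mapsto\Phi^i_{x,y}(\sqrt t)$ is convex on $[0,\infty)$. For an open set $U\subset\mathbb R^N$, $L_{\widehat\Phi^i_x}(U)$ is the set of measurable $u:U\to\mathbb R$ with $\int_U\widehat\Phi^i_x(\lambda|u(x)|)\,dx<\infty$ for some $\lambda>0$, with the norm $\|u\|_{\widehat\Phi^i_x}=\inf\{\lambda>0:\int_U\widehat\Phi^i_x(|u(x)|/\lambda)\,dx\le1\}$. The space $W^{s_i}L_{\Phi^i_{x,y}}(U)$ is the set of $u\in L_{\widehat\Phi^i_x}(U)$ with $\int_U\int_U\Phi^i_{x,y}\left(\frac{\lambda|u(x)-u(y)|}{|x-y|^{s_i}}\right)\frac{dx\,dy}{|x-y|^N}<\infty$ for some $\lambda>0$, with norm $\|u\|_{\widehat\Phi^i_x}+\inf\left\{\lambda>0:\int_U\int_U\Phi^i_{x,y}\left(\frac{|u(x)-u(y)|}{\lambda|x-y|^{s_i}}\right)\frac{dx\,dy}{|x-y|^N}\le1\right\}$; for $U=\Omega$ this norm is denoted $\|u\|_{s_i,\Phi^i_{x,y}}$, and for $U=\mathbb R^N$ it is denoted $\|u\|_{W^{s_i}L_{\Phi^i_{x,y}}(\mathbb R^N)}$. The space $W^{s_i}L_{\Phi^i_{x,y}}(Q)$ is the set of measurable $u:\mathbb R^N\to\mathbb R$ with $u|_\Omega\in L_{\widehat\Phi^i_x}(\Omega)$ and $\int_Q\Phi^i_{x,y}\left(\frac{\lambda|u(x)-u(y)|}{|x-y|^{s_i}}\right)\frac{dx\,dy}{|x-y|^N}<\infty$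 for some $\lambda>0$, with norm $\|u\|_i=\|u\|_{\widehat\Phi^i_x}+[u]_i$, where $\|u\|_{\widehat\Phi^i_x}$ is the norm in $L_{\widehat\Phi^i_x}(\Omega)$ and $[u]_i=\inf\left\{\lambda>0:\int_Q\Phi^i_{x,y}\left(\frac{|u(x)-u(y)|}{\lambda|x-y|^{s_i}}\right)\frac{dx\,dy}{|x-y|^N}\le1\right\}$. $W_0^{s_i}L_{\Phi^i_{x,y}}(Q)=\{u\in W^{s_i}L_{\Phi^i_{x,y}}(Q):u=0\text{ a.e. in }\mathbb R^N\setminus\Omega\}$. *)

(* Defs.v *)
From HB Require Import structures.
From mathcomp Require Import all_boot all_order all_algebra.
From mathcomp Require Import all_classical all_reals all_analysis.

Set Implicit Arguments.
Unset Strict Implicit.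
Unset Printing Implicit Defensive.
Import Order.TTheory GRing.Theory Num.Theory.
Import numFieldNormedType.Exports.

Local Open Scope classical_set_scope.
Local Open Scope ring_scope.

(** * Lebesgue measure on R^n

    The outer measure is the infimum of the total volume of the countable
    families of closed boxes that cover a set; the measure is its restriction
    to the Caratheodory-measurable sets, so measurability in this file means
    Lebesgue measurability and the measure is complete. *)

Section LebesgueMeasure.
Context {R : realType} (n : nat).

Definition box (c : 'rV[R]_n * 'rV[R]_n) : set 'rV[R]_n :=
  [set x | forall j, c.1 0 j <= x 0 j <= c.2 0 j].

Definition box_vol (c : 'rV[R]_n * 'rV[R]_n) : R :=
  \prod_(j < n) Num.max 0 (c.2 0 j - c.1 0 j).

(* The set of indices [p.1] allows finite, even empty, families. *)
Definition box_cover (A : set 'rV[R]_n) :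
    set (set nat * (nat -> 'rV[R]_n * 'rV[R]_n)) :=
  [set p | A `<=` \bigcup_(k in p.1) box (p.2 k)].

Definition lebesgue_outer (A : set 'rV[R]_n) : \bar R :=
  ereal_inf [set (\esum_(k in p.1) (box_vol (p.2 k))%:E)%E | p in box_cover A].

Lemma box_vol_ge0 c : 0 <= box_vol c.
Proof. by apply: prodr_ge0 => j _; rewrite le_max lexx. Qed.

Local Open Scope ereal_scope.

Lemma lebesgue_outer0 : lebesgue_outer set0 = 0.
Proof.
apply/eqP; rewrite eq_le; apply/andP; split.
  apply: ereal_inf_lbound.
  by exists (set0, fun=> (0%R, 0%R)) => //=; rewrite esum_set0.
apply: le_ereal_inf_tmp => _ [p _ <-].
by apply: esum_ge0 => k _; rewrite lee_fin box_vol_ge0.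
Qed.

Lemma lebesgue_outer_ge0 A : 0 <= lebesgue_outer A.
Proof.
apply: le_ereal_inf_tmp => _ [p _ <-].
by apply: esum_ge0 => k _; rewrite lee_fin box_vol_ge0.
Qed.

Lemma lebesgue_outer_le : {homo lebesgue_outer : A B / A `<=` B >-> A <= B}.
Proof.
move=> A B AB; apply: ereal_inf_le_tmp => _ [p Bp <-].
by exists p => //; exact: subset_trans AB Bp.
Qed.

Lemma lebesgue_outer_sigma_subadditive : sigma_subadditive lebesgue_outer.
Proof.
move=> A; have [[i ioo]|] := pselect (exists i, lebesgue_outer (A i) = +oo).
  rewrite (eseries_pinfty _ _ ioo) ?leey// => k _.
  by rewrite -ltNye (lt_le_trans _ (lebesgue_outer_ge0 _)).
rewrite -forallNE => Aoo.
apply/lee_addgt0Pr => e e0.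
apply: le_trans (epsilon_trick _ (fun k => lebesgue_outer_ge0 (A k)) (ltW e0)).
have ex k : exists p, box_cover (A k) p /\
    \esum_(j in p.1) (box_vol (p.2 j))%:E <=
    lebesgue_outer (A k) + (e / (2 ^ k.+1)%:R)%:E.
  have ek : (0 < e / (2 ^ k.+1)%:R)%R by rewrite divr_gt0// ltr0n expn_gt0.
  have fA : lebesgue_outer (A k) \is a fin_num.
    by rewrite ge0_fin_numE ?lebesgue_outer_ge0// ltey; apply/eqP/Aoo.
  have [_ [p Ap <-] /ltW pe] := lb_ereal_inf_adherent ek fA.
  by exists p.
have [p Hp] := choice ex.
have /card_esym/ppcard_eqP[f] := card_nat2.
pose K := [set: nat] `*`` (fun k => (p k).1).
apply: (@le_trans _ _ (\esum_(k in K) (box_vol ((p k.1).2 k.2))%:E)).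
  apply: ereal_inf_lbound => /=.
  exists (f @^-1` K, fun k => (p (f k).1).2 (f k).2) => /=.
    move=> x [k _ /(proj1 (Hp k))[j /= pj xj]].
    exists (f^-1%FUN (k, j)) => //=; rewrite invK ?inE//.
  apply/esym/reindex_esum; split => //.
  - by move=> a b _ _; apply: (@inj _ _ _ f); rewrite inE.
  - by move=> y Ky; exists (f^-1%FUN y) => /=; rewrite invK ?inE.
rewrite nneseries_esumT; last first.
  move=> k; rewrite adde_ge0 ?lebesgue_outer_ge0// lee_fin divr_ge0//.
  exact: ltW.
rewrite -(@esum_esum _ _ _ setT (fun k => (p k).1)
    (fun k j => (box_vol ((p k).2 j))%:E)).
  by apply: le_esum => k _; exact: (Hp k).2.
by move=> k j _ _; rewrite lee_fin box_vol_ge0.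
Qed.

HB.instance Definition _ := isOuterMeasure.Build R 'rV[R]_n lebesgue_outer
  lebesgue_outer0 lebesgue_outer_ge0 lebesgue_outer_le
  lebesgue_outer_sigma_subadditive.

End LebesgueMeasure.

Arguments lebesgue_outer {R n}.

(* A copy of ['rV[R]_n] carrying the Lebesgue sigma-algebra. *)
Notation Rn R n := (caratheodory_type (@lebesgue_outer R n)).

Definition lebesgueN {R : realType} (n : nat) : set (Rn R n) -> \bar R :=
  @lebesgue_outer R n.
Arguments lebesgueN {R} n _.
HB.instance Definition _ (R : realType) (n : nat) :=
  isMeasure.Build _ (Rn R n) R (@lebesgueN R n)
    (@caratheodory_measure0 _ _ (@lebesgue_outer R n))
    (@caratheodory_measure_ge0 _ _ (@lebesgue_outer R n))
    (@caratheodory_measure_sigma_additive _ _ (@lebesgue_outer R n)).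

Definition enorm {R : realType} {n : nat} (x : 'rV[R]_n) : R :=
  Num.sqrt (\sum_(j < n) x 0 j ^+ 2).

(* Points of R^(2n) are row vectors of size n + n, split as (x, y) by
   [lsubmx] and [rsubmx]. *)
Definition prod_set {R : realType} {n : nat} (A B : set 'rV[R]_n) :
    set 'rV[R]_(n + n) :=
  [set z | A (lsubmx z) /\ B (rsubmx z)].

Definition Qset {R : realType} {n : nat} (Omega : set 'rV[R]_n) :
    set 'rV[R]_(n + n) :=
  ~` prod_set (~` Omega) (~` Omega).

(** * Structure of the nonlinearity *)

Definition increasing_homeo {R : realType} (f : R -> R) : Prop :=
  [/\ {homo f : t t' / t < t'}, continuous f &
      exists g : R -> R, [/\ cancel f g, cancel g f & continuous g]].

Section Nonlinearity.
Context {R : realType} {n : nat}.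
Implicit Type a : 'rV[R]_n -> 'rV[R]_n -> R -> R.

Definition varphi a (x y : 'rV[R]_n) (t : R) : R :=
  if t == 0 then 0 else a x y `|t| * t.

(* Only meaningful, and only used, for [0 <= t]. *)
Definition Phi a (x y : 'rV[R]_n) (t : R) : R :=
  \int[lebesgue_measure]_(tau in `[0, t]) varphi a x y tau.

Definition Phi_hat a (x : 'rV[R]_n) (t : R) : R := Phi a x x t.

Definition musielak (F : 'rV[R]_n -> 'rV[R]_n -> R -> R) : Prop :=
  (forall x y, [/\ F x y 0 = 0,
     forall t, 0 < t -> 0 < F x y t,
     {in `[0, +oo[ &, {homo F x y : t t' / t <= t'}},
     {within `[0, +oo[, continuous (F x y)} &
     F x y t @[t --> +oo] --> +oo]) /\
  (forall t, 0 <= t ->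
     measurable_fun [set: Rn R (n + n)]
       (fun z : Rn R (n + n) => F (lsubmx z) (rsubmx z) t)).

Definition cond_Phi1 a : Prop :=
  exists pminus pplus : R, 1 < pminus /\
    forall x y t, 0 < t ->
      pminus <= t * varphi a x y t / Phi a x y t <= pplus.

Definition cond_Phi2 a : Prop :=
  forall x y,
    convex_function [set t : R^o | 0 <= t] (fun t => Phi a x y (Num.sqrt t)).

Definition admissible a : Prop :=
  [/\ forall x y t, a x y t = a y x t,
      forall x y, increasing_homeo (varphi a x y),
      musielak (Phi a), cond_Phi1 a & cond_Phi2 a].

End Nonlinearity.

(** * Musielak-Lebesgue and fractional Musielak-Sobolev spaces

    A function defined on [U] is represented by a total function, of which
    only the values on [U] matter.  Norms take values in [\bar R], the infimum
    of the empty set being [+oo]; they are finite on the corresponding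
    spaces. *)

Section Spaces.
Context {R : realType} {n : nat}.
Variables (a : 'rV[R]_n -> 'rV[R]_n -> R -> R) (s : R).
Implicit Types (U Omega : set 'rV[R]_n) (D : set 'rV[R]_(n + n)).
Implicit Type u : 'rV[R]_n -> R.
Local Open Scope ereal_scope.

(* Modular of [c * u] in the Musielak-Lebesgue space on [U]. *)
Definition modularL U (c : R) u : \bar R :=
  \int[lebesgueN n]_(x in (U : set (Rn R n)))
    (Phi_hat a x (c * `|u x|))%:E.

(* Modular of [c * u] for the fractional difference quotients on [D]; the
   integrand is 0 on the diagonal, which has measure zero. *)
Definition modularS D (c : R) u : \bar R :=
  \int[lebesgueN (n + n)]_(z in (D : set (Rn R (n + n))))
    (Phi a (lsubmx z) (rsubmx z)
       (c * `|u (lsubmx z) - u (rsubmx z)|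
          / enorm (lsubmx z - rsubmx z) `^ s)
     / enorm (lsubmx z - rsubmx z) ^+ n)%:E.

Definition luxemburg (rho : R -> \bar R) : \bar R :=
  ereal_inf [set l%:E | l in [set l : R | (0 < l)%R /\ rho l^-1%R <= 1]].

Definition spaceL U : set ('rV[R]_n -> R) :=
  [set u | measurable_fun (U : set (Rn R n)) (u : Rn R n -> R) /\
    exists2 l : R, (0 < l)%R & modularL U l u < +oo].

Definition normL U u : \bar R := luxemburg (fun c => modularL U c u).

Definition seminormS D u : \bar R := luxemburg (fun c => modularS D c u).

(* W^s L_Phi(U) *)
Definition spaceW U : set ('rV[R]_n -> R) :=
  [set u | spaceL U u /\
    exists2 l : R, (0 < l)%R & modularS (prod_set U U) l u < +oo].

Definition normW U u : \bar R := normL U u + seminormS (prod_set U U) u.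

(* W^s L_Phi(Q) *)
Definition spaceWQ Omega : set ('rV[R]_n -> R) :=
  [set u | [/\ measurable_fun [set: Rn R n] (u : Rn R n -> R),
    spaceL Omega u &
    exists2 l : R, (0 < l)%R & modularS (Qset Omega) l u < +oo]].

Definition normWQ Omega u : \bar R :=
  normL Omega u + seminormS (Qset Omega) u.

Definition spaceWQ0 Omega : set ('rV[R]_n -> R) :=
  [set u | spaceWQ Omega u /\
    {ae lebesgueN n, forall x : Rn R n, ~ Omega x -> u x = 0%R}].

End Spaces.

(* [r] maps the space [X] continuously into the space [Y]; for the linear maps
   [r] considered here, continuity is boundedness. *)
Definition continuous_embedding {R : realType} {V W : Type}
    (X : set V) (normX : V -> \bar R) (Y : set W) (normY : W -> \bar R)
    (r : V -> W) : Prop :=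
  (forall u, X u -> Y (r u)) /\
  exists2 C : R, 0 < C &
    forall u, X u -> (normY (r u) <= C%:E * normX u)%E.

(* Main.v *)
(** Since Omega x Omega is contained in Q, the restricted modulars are dominated
    by those on Q, which gives the embedding with constant 1.  If u vanishes
    almost everywhere outside Omega, then u(x) = u(y) for almost every (x, y) in
    the complement of Q, because Z x R^n and R^n x Z are null sets of R^(2n) as
    soon as Z is a null set of R^n.  Hence the modulars on R^n and R^(2n) are
    equal to those on Omega and Q. *)

Require Import Defs.
From HB Require Import structures.
From mathcomp Require Import all_boot all_order all_algebra.
From mathcomp Require Import all_classical all_reals all_analysis.

Set Implicit Arguments.
Unset Strict Implicit.

Import Order.TTheory GRing.Theory Num.Theory.
Import numFieldNormedType.Exports.

Local Open Scope classical_set_scope.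
Local Open Scope ring_scope.

(** * Comparison of integrals under an almost everywhere inequality *)

Section AeMonotonicity.
Context d (T : measurableType d) (R : realType).
Context (mu : {measure set T -> \bar R}).
Local Open Scope ereal_scope.
Import HBNNSimple.

(* No measurability is required: the integral is a supremum over the simple
   functions below the integrand, and these may be set to 0 on a null set. *)
Lemma ae_ge0_le_integral (D E : set T) (f g : T -> \bar R) :
  (forall x, D x -> 0 <= f x) -> (forall x, E x -> 0 <= g x) ->
  {ae mu, forall x, (f \_ D) x <= (g \_ E) x} ->
  \int[mu]_(x in D) f x <= \int[mu]_(x in E) g x.
Proof.
move=> f0 g0 [N [mN N0 fgN]]; rewrite !ge0_integralE//.
apply: ge_ereal_sup => _ [h /= hf <-].
have [h' h'E] : exists h' : {nnsfun T >-> R}, h' = h \_ (~` N) :> (T -> R).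
  by exists (proj_nnsfun h (measurableC mN)); rewrite -mrestrict.
(* Written as integrals, the two simple integrals differ only over the null set [N], which can be
   discarded. *)
have -> : sintegral mu h = sintegral mu h'.
  transitivity (\int[mu]_(x in setT) (h x)%:E).
    by rewrite integral_nnsfun// patch_setT.
  rewrite h'E -(integral_nnsfun mu (measurableC mN)).
  rewrite -setTD; apply: ge0_negligible_integral => //.
  - exact/measurable_realfun.measurable_EFinP.
  - by move=> x _; rewrite lee_fin.
apply: ereal_sup_ubound; exists h' => //= x.
rewrite h'E patchE; case: ifPn => [|_].
  rewrite inE => Nx; apply: le_trans (hf x) _.
  by apply: contrapT => fgx; apply: Nx; exact: fgN.
by rewrite patchE; case: ifPn => [/set_mem/g0|].
Qed.

End AeMonotonicity.

(** * Null sets of the Lebesgue outer measure and their cylinders *)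

Section LebesgueNullSets.
Context {R : realType}.
Local Open Scope ereal_scope.

(** Applied to each box, [h] turns a cover of [A] into a cover of [S] whose total volume is [K]
    times as large. Below, [p] is a coordinate projection and [h] takes the product with a fixed
    cube. *)
Lemma lebesgue_outer_le_scale m n (A : set 'rV[R]_m) (S : set 'rV[R]_n)
    (p : 'rV[R]_n -> 'rV[R]_m)
    (h : 'rV[R]_m * 'rV[R]_m -> 'rV[R]_n * 'rV[R]_n) (K : R) :
  (0 < K)%R ->
  (forall c, box_vol (h c) = K * box_vol c)%R ->
  (forall z, S z -> A (p z)) ->
  (forall c z, S z -> box c (p z) -> box (h c) z) ->
  lebesgue_outer S <= K%:E * lebesgue_outer A.
Proof.
(* Division by [K] isolates the infimum over covers of [A], so one cover at a time can be
   treated. *)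
move=> K0 hK SA Sh; rewrite -lee_pdivrMl//.
apply: le_ereal_inf_tmp => _ [q Aq <-]; rewrite lee_pdivrMl//.
apply: (@le_trans _ _ (\esum_(k in q.1) (box_vol (h (q.2 k)))%:E)).
  apply: ereal_inf_lbound; exists (q.1, h \o q.2) => //= z Sz.
  by have [k qk zk] := Aq _ (SA _ Sz); exists k => //=; exact: Sh.
(* The sum of the volumes is a supremum of finite sums, and [K] factors out of each of these. *)
apply: ge_ereal_sup => _ [F [finF Fq] <-].
under eq_fsbigr do rewrite hK EFinM.
rewrite -ge0_mule_fsumr; last by move=> k; rewrite lee_fin box_vol_ge0.
by rewrite lee_pmul2l// ?ltry// ?fin_numE//; apply: ereal_sup_ubound; exists F.
Qed.

Lemma lebesgue_outer_bigcup0 n (S : nat -> set 'rV[R]_n) :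
  (forall k, lebesgue_outer (S k) = 0) -> lebesgue_outer (\bigcup_k S k) = 0.
Proof.
move=> S0; apply/eqP; rewrite eq_le outer_measure_ge0 andbT.
apply: le_trans (outer_measure_sigma_subadditive _ S) _.
by rewrite eseries0// => k _ _; exact: S0.
Qed.

(** The successor keeps the volume positive even for [k = 0], as a scaling factor must be. *)
Definition cube n (k : nat) : 'rV[R]_n * 'rV[R]_n :=
  (const_mx (- k.+1%:R), const_mx k.+1%:R)%R.

Lemma box_vol_cube_gt0 n k : (0 < box_vol (cube n k))%R.
Proof.
apply: prodr_gt0 => j _; rewrite !mxE opprK lt_max -natrD ltr0n.
by rewrite orbT.
Qed.

Lemma bigcup_cube n (x : 'rV[R]_n) : exists k, box (cube n k) x.
Proof.
exists (\max_(j < n) Num.bound `|x 0%R j|)%N => j; rewrite !mxE -ler_norml.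
apply: le_trans (ltW (archi_boundP (normr_ge0 _))) _.
by rewrite ler_nat ltnW// ltnS leq_bigmax.
Qed.

Definition box_prod m n (c : 'rV[R]_m * 'rV[R]_m) (c' : 'rV[R]_n * 'rV[R]_n) :=
  (row_mx c.1 c'.1, row_mx c.2 c'.2).

Lemma box_vol_prod m n (c : 'rV[R]_m * 'rV[R]_m) (c' : 'rV[R]_n * 'rV[R]_n) :
  box_vol (box_prod c c') = (box_vol c * box_vol c')%R.
Proof.
rewrite /box_vol big_split_ord /=; congr (_ * _)%R; apply: eq_bigr => j _.
  by rewrite !row_mxEl.
by rewrite !row_mxEr.
Qed.

Lemma box_prodP m n (c : 'rV[R]_m * 'rV[R]_m) (c' : 'rV[R]_n * 'rV[R]_n) z :
  box c (lsubmx z) -> box c' (rsubmx z) -> box (box_prod c c') z.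
Proof.
move=> cz c'z j; case: (split_ordP j) => i ->.
  by rewrite !row_mxEl; have := cz i; rewrite mxE.
by rewrite !row_mxEr; have := c'z i; rewrite mxE.
Qed.

(** By completeness, a set of outer measure zero is measurable and can itself serve as the
    exceptional set. *)
Lemma ae_lebesgueNP n (P : Rn R n -> Prop) :
  {ae lebesgueN n, forall x, P x} <-> lebesgue_outer (~` [set x | P x]) = 0.
Proof.
split=> [[N [mN N0 PN]]|P0].
  apply/eqP; rewrite eq_le outer_measure_ge0 andbT -N0.
  exact: le_outer_measure.
exists (~` [set x | P x]); split => //.
apply: le_caratheodory_measurable => X.
(* The part of [X] inside the null set has outer measure zero; monotonicity bounds the other
   part. *)
rewrite [X in X + _ <= _](_ : _ = 0) ?add0e ?le_outer_measure//.
by apply/eqP; rewrite eq_le outer_measure_ge0 andbT -P0 le_outer_measure.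
Qed.

(** The exceptional set is a cylinder over a null set. Cutting the free factor by cubes gives
    countably many pieces, each of outer measure at most the finite volume of a cube times zero.
    This replaces an appeal to Fubini. *)
Lemma ae_lsubmx m n (P : 'rV[R]_m -> Prop) :
  {ae lebesgueN m, forall x : Rn R m, P x} ->
  {ae lebesgueN (m + n), forall z : Rn R (m + n), P (lsubmx z)}.
Proof.
move=> /ae_lebesgueNP P0; apply/ae_lebesgueNP.
set S := ~` _.
have -> : S = \bigcup_k (S `&` [set z | box (cube n k) (rsubmx z)]).
  rewrite -setI_bigcupr; apply/esym/setIidl => z _.
  by have [k zk] := bigcup_cube (rsubmx z); exists k.
apply: lebesgue_outer_bigcup0 => k; apply/eqP.
rewrite eq_le outer_measure_ge0 andbT.
have := @lebesgue_outer_le_scale _ _ (~` [set x | P x])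
  (S `&` [set z | box (cube n k) (rsubmx z)]) lsubmx
  (fun c => box_prod c (cube n k))
  (box_vol (cube n k)).
rewrite P0 mule0; apply.
- exact: box_vol_cube_gt0.
- by move=> c; rewrite box_vol_prod mulrC.
- by move=> z [].
- by move=> c z [_ zk] cz; exact: box_prodP.
Qed.

Lemma ae_rsubmx m n (P : 'rV[R]_n -> Prop) :
  {ae lebesgueN n, forall x : Rn R n, P x} ->
  {ae lebesgueN (m + n), forall z : Rn R (m + n), P (rsubmx z)}.
Proof.
move=> /ae_lebesgueNP P0; apply/ae_lebesgueNP.
set S := ~` _.
have -> : S = \bigcup_k (S `&` [set z | box (cube m k) (lsubmx z)]).
  rewrite -setI_bigcupr; apply/esym/setIidl => z _.
  by have [k zk] := bigcup_cube (lsubmx z); exists k.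
apply: lebesgue_outer_bigcup0 => k; apply/eqP.
rewrite eq_le outer_measure_ge0 andbT.
have := @lebesgue_outer_le_scale _ _ (~` [set x | P x])
  (S `&` [set z | box (cube m k) (lsubmx z)]) rsubmx (box_prod (cube m k))
  (box_vol (cube m k)).
rewrite P0 mule0; apply.
- exact: box_vol_cube_gt0.
- by move=> c; rewrite box_vol_prod.
- by move=> z [].
- by move=> c z [_ zk] cz; exact: box_prodP.
Qed.

End LebesgueNullSets.

(** * Modulars on different domains *)

Section Modulars.
Context {R : realType} {n : nat}.
Context (a : 'rV[R]_n -> 'rV[R]_n -> R -> R) (s : R).
Context (Phi_musielak : musielak (Phi a)).
Implicit Types (U Omega : set 'rV[R]_n) (D : set 'rV[R]_(n + n)).
Implicit Type u : 'rV[R]_n -> R.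

Lemma Phi_ge0 x y t : 0 <= t -> 0 <= Phi a x y t.
Proof.
have [Phi0 Phi_gt0 _ _ _] := Phi_musielak.1 x y.
by rewrite le_eqVlt => /predU1P[<-|/Phi_gt0/ltW//]; rewrite Phi0.
Qed.

Lemma Phi0 x y : Phi a x y 0 = 0.
Proof. by have [] := Phi_musielak.1 x y. Qed.

Definition slope_density (c : R) u (z : 'rV[R]_(n + n)) : R :=
  Phi a (lsubmx z) (rsubmx z)
    (c * `|u (lsubmx z) - u (rsubmx z)|
       / enorm (lsubmx z - rsubmx z) `^ s)
  / enorm (lsubmx z - rsubmx z) ^+ n.

Lemma slope_density_ge0 c u z : 0 <= c -> 0 <= slope_density c u z.
Proof.
move=> c0; rewrite divr_ge0 ?exprn_ge0 ?sqrtr_ge0// Phi_ge0//.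
by rewrite divr_ge0 ?powR_ge0// mulr_ge0.
Qed.

Lemma slope_density_eq0 c u z :
  u (lsubmx z) = u (rsubmx z) -> slope_density c u z = 0.
Proof.
by move=> uz; rewrite /slope_density uz subrr normr0 mulr0 mul0r Phi0 mul0r.
Qed.

Local Open Scope ereal_scope.

(** Almost everywhere on [D] minus [E] the difference of values is zero, hence so is the integrand;
    on the rest of [E] the integrand is nonnegative. Both inclusions of domains and functions
    vanishing outside [Omega] are instances. *)
Lemma modularS_le_ae D E c u : (0 <= c)%R ->
  {ae lebesgueN (n + n), forall z : Rn R (n + n),
    D z -> ~ E z -> u (lsubmx z) = u (rsubmx z)} ->
  modularS a s D c u <= modularS a s E c u.
Proof.
move=> c0 uDE; apply: ae_ge0_le_integral => [z _|z _|];
  rewrite ?lee_fin; try exact: slope_density_ge0.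
apply: filterS uDE => z uz; rewrite !patchE.
case: ifPn => [/set_mem Dz|_]; case: ifPn => [_|/negP Ez] //.
  rewrite lee_fin -/(slope_density c u z) slope_density_eq0// uz//.
  by move=> /mem_set.
by rewrite lee_fin; exact: slope_density_ge0.
Qed.

Lemma modularL_le_ae U V c u : (0 <= c)%R ->
  {ae lebesgueN n, forall x : Rn R n, U x -> ~ V x -> u x = 0%R} ->
  modularL a U c u <= modularL a V c u.
Proof.
move=> c0 uUV.
have Phi_hat_ge0 x : (0 <= Phi_hat a x (c * `|u x|))%R.
  by rewrite Phi_ge0 ?mulr_ge0.
apply: ae_ge0_le_integral => [x _|x _|]; rewrite ?lee_fin//.
apply: filterS uUV => x ux; rewrite !patchE.
case: ifPn => [/set_mem Ux|_]; case: ifPn => [_|/negP Vx] //.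
  by rewrite /Phi_hat ux// ?normr0 ?mulr0 ?Phi0// => /mem_set.
by rewrite lee_fin.
Qed.

Lemma le_modularS D E c u : (0 <= c)%R -> D `<=` E ->
  modularS a s D c u <= modularS a s E c u.
Proof.
move=> c0 DE; apply: modularS_le_ae => //.
by apply: filterE => z Dz /(_ (DE _ Dz)).
Qed.

Lemma le_modularL U V c u : (0 <= c)%R -> U `<=` V ->
  modularL a U c u <= modularL a V c u.
Proof.
move=> c0 UV; apply: modularL_le_ae => //.
by apply: filterE => x Ux /(_ (UV _ Ux)).
Qed.

Lemma prod_set_sub_Qset Omega : prod_set Omega Omega `<=` Qset Omega.
Proof. by move=> z [zO _] []. Qed.

(** Restriction to [Omega] is represented by truncation to zero outside, which a modular on [Omega]
    does not see. *)
Lemma modularS_restrict Omega c u :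
  modularS a s (prod_set Omega Omega) c (u \_ Omega) =
  modularS a s (prod_set Omega Omega) c u.
Proof.
by apply: eq_integral => z /set_mem[lz rz]; rewrite !patchE !mem_set.
Qed.

Lemma modularL_restrict Omega c u :
  modularL a Omega c (u \_ Omega) = modularL a Omega c u.
Proof. by apply: eq_integral => x /set_mem xO; rewrite patchE mem_set. Qed.

Lemma spaceL_restrict Omega u :
  spaceL a Omega u -> spaceL a Omega (u \_ Omega).
Proof.
move=> [mu [l l0 ul]]; split; last by exists l; rewrite ?modularL_restrict.
by apply: eq_measurable_fun mu => x xO; rewrite patchE xO.
Qed.

Lemma modularS_full Omega c u : (0 <= c)%R ->
  {ae lebesgueN n, forall x : Rn R n, ~ Omega x -> u x = 0%R} ->
  modularS a s (prod_set setT setT) c u = modularS a s (Qset Omega) c u.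
Proof.
move=> c0 u0; apply/eqP; rewrite eq_le; apply/andP; split; last first.
  by apply: le_modularS.
apply: modularS_le_ae => //.
(* Lying outside [Qset Omega] is a double negation of having both halves outside [Omega]. *)
apply: filterS2 (ae_lsubmx n u0) (ae_rsubmx n u0) => z lz rz _ /contrapT[lO rO].
by rewrite lz// rz.
Qed.

Lemma modularL_full Omega c u : (0 <= c)%R ->
  {ae lebesgueN n, forall x : Rn R n, ~ Omega x -> u x = 0%R} ->
  modularL a setT c u = modularL a Omega c u.
Proof.
move=> c0 u0; apply/eqP; rewrite eq_le; apply/andP; split; last exact: le_modularL.
by apply: modularL_le_ae => //; apply: filterS u0 => x u0 _.
Qed.

(** * Luxemburg norms, the embedding and extension by zero *)

(** A smaller modular admits more values [l] in the infimum. Only [c = l^-1] with [l] positive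
    occurs, so positive [c] suffice. *)
Lemma le_luxemburg (rho rho' : R -> \bar R) :
  (forall c, (0 < c)%R -> rho c <= rho' c) -> luxemburg rho <= luxemburg rho'.
Proof.
move=> rho_le; apply: ereal_inf_le_tmp => _ [l [l0 rl] <-].
by exists l => //; split=> //; apply: le_trans rl; rewrite rho_le// invr_gt0.
Qed.

Lemma eq_luxemburg (rho rho' : R -> \bar R) :
  (forall c, (0 < c)%R -> rho c = rho' c) -> luxemburg rho = luxemburg rho'.
Proof.
by move=> rhoE; apply/eqP; rewrite eq_le; apply/andP; split;
  apply: le_luxemburg => c /rhoE->.
Qed.

Lemma continuous_embedding_WQ Omega :
  continuous_embedding (spaceWQ a s Omega) (normWQ a s Omega)
    (spaceW a s Omega) (normW a s Omega) (fun u => u \_ Omega).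
Proof.
split=> [u [_ Lu [l l0 ul]]|].
  split; first exact: spaceL_restrict.
  exists l; first exact: l0.
  rewrite modularS_restrict; apply: le_lt_trans ul.
  exact: (le_modularS u (ltW l0) (@prod_set_sub_Qset Omega)).
exists 1%R => // u _; rewrite mul1e; apply: leeD.
  by apply: le_luxemburg => c _; rewrite modularL_restrict.
apply: le_luxemburg => c c0; rewrite modularS_restrict.
exact: (le_modularS u (ltW c0) (@prod_set_sub_Qset Omega)).
Qed.

Lemma spaceWQ0_spaceW Omega u :
  spaceWQ0 a s Omega u -> spaceW a s setT u.
Proof.
(* The scales [l] and [k] found on [Omega] and on Q serve unchanged on the whole spaces;
   measurability on the whole space is already part of [spaceWQ]. *)
move=> [[mu [_ [l l0 ul]] [k k0 uk]] u0]; split.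
  by split=> //; exists l; [exact: l0|rewrite (modularL_full (ltW l0) u0)].
by exists k; [exact: k0|rewrite (modularS_full (ltW k0) u0)].
Qed.

Lemma normW_full Omega u :
  {ae lebesgueN n, forall x : Rn R n, ~ Omega x -> u x = 0%R} ->
  normW a s setT u = normWQ a s Omega u.
Proof.
move=> u0; congr (_ + _); apply: eq_luxemburg => c /ltW c0.
  exact: modularL_full.
exact: modularS_full.
Qed.

Lemma le_normW U V u : U `<=` V -> normW a s U u <= normW a s V u.
Proof.
move=> UV; apply: leeD; apply: le_luxemburg => c /ltW c0.
  exact: le_modularL.
by apply: le_modularS => // z [lz rz]; split; exact: UV.
Qed.

End Modulars.

Unset Implicit Arguments.
Set Strict Implicit.

Theorem theorem3p1 (R : realType) (N : nat) (Omega : set 'rV[R]_N)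
    (s : 'I_N -> R) (a : 'I_N -> 'rV[R]_N -> 'rV[R]_N -> R -> R) :
  (1 <= N)%N ->
  open Omega ->
  (forall i, 0 < s i < 1) ->
  (forall i, admissible (a i)) ->
  forall i : 'I_N,
    continuous_embedding
      (spaceWQ (a i) (s i) Omega) (normWQ (a i) (s i) Omega)
      (spaceW (a i) (s i) Omega) (normW (a i) (s i) Omega)
      (fun u => u \_ Omega)
    /\
    (forall u, spaceWQ0 (a i) (s i) Omega u ->
      [/\ spaceW (a i) (s i) [set: 'rV[R]_N] u,
          (normW (a i) (s i) Omega u
             <= normW (a i) (s i) [set: 'rV[R]_N] u)%E &
          normW (a i) (s i) [set: 'rV[R]_N] u = normWQ (a i) (s i) Omega u]).
Proof.
move=> _ _ _ ha i; have [_ _ Phi_mus _ _] := ha i.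
split; first exact: continuous_embedding_WQ.
move=> u uW; split.
- exact: spaceWQ0_spaceW uW.
- exact: le_normW.
- exact: normW_full uW.2.
Qed.
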